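(* Let $N=\{0,1,\dots,n\}$ and let $G\subseteq K_{n+1}$ be a subgraph of the complete graph on vertex set $N$, with edge set $U(G)$. Then the type domain of the parallelotope $Z_b(G)$ is the open cone $\mathcal{C}(G)$ of cut submodular set functions defined on the graph $G$. It is in one-to-one correspondence with a face of the closure of the principal domain of quadratic forms.
   Context: Let $e_0,\dots,e_n$ be an orthonormal basis of $\mathbb{R}^N=\mathbb{R}^{n+1}$ and $e_S=\sum_{i\in S}e_i$ for $S\subseteq N$. For an edge $u=(i,j)$ of $K_{n+1}$ with $i<j$ put $t(u)=e_i-e_j$, and for a vector $t$ let $z(t)=\{\lambda t:-1\le\lambda\le 1\}$. Sums of segments are Minkowski sums. Subgraphs of $K_{n+1}$ are regarded as having vertex set $N$. For an edge $u$ and $S\subseteq N$, $\delta_u(S)=1$ if exactly one end of $u$ lies in $S$, and $\delta_u(S)=0$ otherwise. A cut (submodular) set function is a function $\beta:2^N\to\mathbb{R}$ of the form $\beta=\sum_u b_u\delta_u$, the sum over all edges $u$ of $K_{n+1}$, with all $b_u\ge 0$. Such a function satisfies $\beta(S)+\beta(T)\ge\beta(S\cap T)+\beta(S\cup T)$ for all $S,T\subseteq N$ (submodularity). The open cone of cut functions defined on $G$ is $$\mathcal{C}(G)=\Big\{\sum_{u\in U(G)}b_u\delta_u:\ b_u>0\text{ for all }u\in U(G)\Big\}.$$ For a cut function $\beta$, let $P(\beta)=\{x\in\mathbb{R}^N:\langle e_S,x\rangle\le\beta(S)\text{ for all }S\subset N,\ \langle e_N,x\rangle=0\}$. For weights $b_u>0$,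 $u\in U(G)$, the parallelotope $Z_b(G)$ is the zonotope $$Z_b(G)=\sum_{u\in U(G)}b_u z(t(u))=P(\beta_G),\qquad \beta_G=\sum_{u\in U(G)}b_u\delta_u.$$ The type of a polytope is the isomorphism class of its face lattice. For a cut function $\beta_0$, the type domain of $P(\beta_0)$ is the connected component containing $\beta_0$ of the set of all cut functions $\beta$ such that $P(\beta)$ has the same type as $P(\beta_0)$. The closure of the principal domain is the cone of quadratic forms $f(x)=\sum_{0\le i<j\le n}b_{ij}(x_i-x_j)^2$ with all $b_{ij}\ge 0$, where $x\in\mathbb{R}^N$, $\sum_{i\in N}x_i=0$. Its extreme rays are spanned by the $\frac12 n(n+1)$ forms $(x_i-x_j)^2=\langle e_i-e_j,x\rangle^2$, and every subset of these forms generates a face of it. *)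

(* Defs.v *)
From HB Require Import structures.
From mathcomp Require Import all_boot all_order all_algebra.
From mathcomp Require Import all_classical all_reals all_analysis.
Set Implicit Arguments.
Unset Strict Implicit.
Unset Printing Implicit Defensive.
Import Order.TTheory GRing.Theory Num.Theory.
Import numFieldNormedType.Exports.
Local Open Scope classical_set_scope.
Local Open Scope ring_scope.

Section Convex.
Variables (R : realType) (V : lmodType R).

(* A face is cut out by a valid linear inequality; the empty set (l = 0, c = 1)
   and K itself (l = 0, c = 0) are faces. *)
Definition is_face (K F : set V) : Prop :=
  exists (l : {linear V -> R^o}) (c : R),
    (forall x, K x -> l x <= c) /\ F = K `&` [set x | l x = c].

Definition faces (K : set V) : set (set V) := [set F | is_face K F].

(* Isomorphic face lattices: for lattices, isomorphisms are exactly the order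
   isomorphisms. *)
Definition same_type (K L : set V) : Prop :=
  exists2 phi : set V -> set V, set_bij (faces K) (faces L) phi &
    forall F F', is_face K F -> is_face K F' ->
      (F `<=` F' <-> phi F `<=` phi F').

(* Relative interior of a convex set, in its algebraic form: every segment of
   F ending at x can be prolonged beyond x inside F. *)
Definition relint (F : set V) : set V :=
  [set x | F x /\
    forall y, F y -> exists2 eps : R, 0 < eps & F (x + eps *: (x - y))].

Definition segment (t : V) : set V :=
  [set x | exists2 a : R, -1 <= a <= 1 & x = a *: t].

Definition minkowski_sum (I : finType) (A : {set I}) (K : I -> set V) : set V :=
  [set x | exists2 p : I -> V,
    (forall i, i \in A -> K i (p i)) & x = \sum_(i in A) p i].

End Convex.

(* Edges of K_{n+1}; a spanning subgraph is a set G : {set edge n}. *)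
Definition edge (n : nat) :=
  {u : 'I_n.+1 * 'I_n.+1 | (u.1 < u.2)%N}.

Section CutFunctions.
Variables (R : realType) (n : nat).
Implicit Types (S : {set 'I_n.+1}) (G : {set edge n}) (b : edge n -> R).

Definition dot (x y : 'rV[R]_n.+1) : R := \sum_i x 0 i * y 0 i.

Definition basis_vec (i : 'I_n.+1) : 'rV[R]_n.+1 := delta_mx 0 i.

Definition ind_vec S : 'rV[R]_n.+1 := \sum_(i in S) basis_vec i.

Definition edge_vec (u : edge n) : 'rV[R]_n.+1 :=
  basis_vec (val u).1 - basis_vec (val u).2.

(* Functions 2^N -> R, a vector space with pointwise operations. Where a
   topology is needed it is that of pointwise convergence, i.e. the usual one
   of this finite-dimensional space. *)
Definition setfun := {set 'I_n.+1} -> R^o.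

Definition delta (u : edge n) : setfun :=
  fun S => (((val u).1 \in S) (+) ((val u).2 \in S))%:R.

Definition cutfun G b : setfun := \sum_(u in G) b u *: delta u.

Definition is_cut (beta : setfun) : Prop :=
  exists2 b : edge n -> R, (forall u, 0 <= b u) & beta = \sum_u b u *: delta u.

Definition cut_cone G : set setfun :=
  [set beta | exists2 b : edge n -> R,
    (forall u, u \in G -> 0 < b u) & beta = cutfun G b].

Definition polytope (beta : setfun) : set 'rV[R]_n.+1 :=
  [set x | (forall S, S \proper [set: 'I_n.+1]%SET -> dot (ind_vec S) x <= beta S)
           /\ dot (ind_vec [set: 'I_n.+1]%SET) x = 0].

Definition zonotope G b : set 'rV[R]_n.+1 :=
  minkowski_sum G (fun u => [set b u *: x | x in segment (edge_vec u)]).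

Definition type_domain (beta0 : setfun) : set setfun :=
  @connected_component {ptws {set 'I_n.+1} -> R^o}
    [set beta | is_cut beta /\ same_type (polytope beta) (polytope beta0)]
    beta0.

Definition closure_setfun (C : set setfun) : set setfun :=
  @closure {ptws {set 'I_n.+1} -> R^o} C.

Definition hyperplane := {x : 'rV[R]_n.+1 | \sum_i x 0 i == 0}.

(* Quadratic forms on the hyperplane are viewed in the space of all real
   functions on it. *)
Definition formfun := hyperplane -> R^o.

Definition edge_form (u : edge n) : formfun :=
  fun x => (val x 0 (val u).1 - val x 0 (val u).2) ^+ 2.

Definition closed_principal_domain : set formfun :=
  [set f | exists2 b : edge n -> R,
    (forall u, 0 <= b u) & f = \sum_u b u *: edge_form u].

End CutFunctions.

Arguments delta R {n} u.
Arguments cut_cone R {n} G.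
Arguments edge_form R {n} u.
Arguments closed_principal_domain R n : clear implicits.

(* Main.v *)
Require Import Defs.
From HB Require Import structures.
From mathcomp Require Import all_boot all_order all_algebra.
From mathcomp Require Import all_classical all_reals all_analysis.
From mathcomp Require Import zify ring lra.
Set Implicit Arguments.
Unset Strict Implicit.
Unset Printing Implicit Defensive.
Import Order.TTheory GRing.Theory Num.Theory.
Import numFieldNormedType.Exports.
Local Open Scope classical_set_scope.
Local Open Scope ring_scope.

(** Write t(u) for the vector of the edge u and x(S) for the sum of the
coordinates of x over S.

The equality of the zonotope with the polytope of its cut function is proved
by peeling off one edge at a time ([edge_flow_exists]). A point of the
polytope of beta + c delta_u can be moved by a multiple of t(u) into the
polytope of beta as soon as the lower bounds on the multiple, coming from the
sets containing only the first end of u, lie below the upper bounds, coming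
from the sets containing only the second end. That is the submodular
inequality for two such sets, since u crosses neither their intersection nor
their union.

A linear form l exposes the face of the zonotope on which every edge with
l(t(u)) <> 0 has its coefficient at the end of its range given by the sign of
l(t(u)). Hence inclusion of nonempty faces is refinement of sign vectors
([zonotope_face_sub]), which does not see the positive weights: all weights on
one graph give the same type ([zonotope_same_type]). If H is a proper subgraph
of G, restricting sign vectors from G to H maps the faces for G onto those for
H and identifies two of them ([new_edge_splits_cone]); there are finitely many
faces, so the types differ ([zonotope_faces_card_inj]).

The coefficients of a cut function are continuous functions of it
([edge_coef]). Near a cut function of support G the supports can only grow,
and in a limit of such functions they can only shrink. Within one type,
comparable supports are equal, so the cone of G is open and closed in the set
of cut functions of that type; being convex, it is a connected component
([type_domain_cut_cone]).

Finally the form sum_u b_u (x_i - x_j)^2 takes at e_S, or at its projection to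
the hyperplane, the value of sum_u b_u delta_u at S. So the linear map sending
delta_u to the form of u is injective on cut functions, and it carries the
cone of G and its closure to the relative interior and the whole of the face
generated by the forms of the edges of G. *)

(** * Zonotopes as polytopes of cut functions *)

Section Zonotopes.
Variables (R : realType) (n : nat).
Implicit Types (S T : {set 'I_n.+1}) (G H : {set edge n}) (b c : edge n -> R).
Implicit Types (x : 'rV[R]_n.+1) (u v : edge n).

Lemma ind_vecE S i : ind_vec R S 0 i = (i \in S)%:R.
Proof.
rewrite /ind_vec summxE; under eq_bigr do rewrite mxE eqxx /=.
case: (boolP (i \in S)) => iS.
  rewrite (bigD1 i) //= eqxx big1 ?addr0 // => k /andP[_ ki].
  by rewrite eq_sym (negPf ki).
by rewrite big1 // => k kS; case: eqP => // ik; rewrite ik kS in iS.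
Qed.

Lemma dot_ind_vec S x : dot (ind_vec R S) x = \sum_(i in S) x 0 i.
Proof.
rewrite /dot [RHS]big_mkcond; apply: eq_bigr => i _.
by rewrite ind_vecE; case: ifP; rewrite ?mul1r ?mul0r.
Qed.

Lemma edge_vec_mass u S :
  \sum_(i in S) edge_vec R u 0 i =
  ((val u).1 \in S)%:R - ((val u).2 \in S)%:R.
Proof.
have massE k : \sum_(i in S) basis_vec R k 0 i = (k \in S)%:R.
  rewrite -ind_vecE /ind_vec summxE; apply: eq_bigr => i _.
  by rewrite !mxE eq_sym.
by rewrite -!massE -sumrB; apply: eq_bigr => i _; rewrite !mxE.
Qed.

Lemma cutfunE G b S : cutfun G b S = \sum_(u in G) b u * delta R u S.
Proof. by rewrite /cutfun fct_sumE. Qed.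

Lemma cutfun_submodular G b S T : (forall u, u \in G -> 0 <= b u) ->
  cutfun G b (S :&: T)%SET + cutfun G b (S :|: T)%SET
    <= cutfun G b S + cutfun G b T.
Proof.
move=> b0; rewrite !cutfunE -!big_split /=; apply: ler_sum => u uG.
rewrite -!mulrDr ler_wpM2l ?b0 // /delta !inE -!natrD ler_nat.
by do 4 case: (_ \in _).
Qed.

(** The conditions on mu = c * a are mu >= x(S) - beta(S) when S contains only
the first end of u, mu <= beta(T) - x(T) when T contains only the second, and
-c <= mu <= c; the least mu meeting the lower bounds meets them all. *)
Lemma edge_flow_exists (beta : setfun R n) u (c : R) x :
    0 < c ->
    (forall S T, beta (S :&: T)%SET + beta (S :|: T)%SET <= beta S + beta T) ->
    (forall S, \sum_(i in S) x 0 i <= beta S + c * delta R u S) ->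
  exists2 a : R, -1 <= a <= 1 &
    forall S, \sum_(i in S) (x - (c * a) *: edge_vec R u) 0 i <= beta S.
Proof.
move=> c0 submod xle.
pose m S := \sum_(i in S) x 0 i.
pose P S := ((val u).1 \in S) && ((val u).2 \notin S).
pose mu := \big[Num.max/ - c]_(S | P S) (m S - beta S).
have mu_ge : - c <= mu by apply: bigmax_ge_id.
have mu_le : mu <= c.
  apply: bigmax_le => [|S /andP[iS jS]]; first by lra.
  have := xle S; rewrite /delta iS (negPf jS) /= mulr1 -/(m S); lra.
exists (mu / c).
  by rewrite ler_pdivlMr // ler_pdivrMr //; apply/andP; split; lra.
move=> S.
have -> : \sum_(i in S) (x - (c * (mu / c)) *: edge_vec R u) 0 i
   = m S - mu * (((val u).1 \in S)%:R - ((val u).2 \in S)%:R).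
  rewrite -edge_vec_mass mulr_sumr -sumrB; apply: eq_bigr => i _.
  by rewrite !mxE mulrCA divff ?mulr1 // gt_eqF.
have := xle S; rewrite /delta -/(m S).
case iS: (_ \in S); case jS: (_ \in S) => /=; rewrite ?mulr1 ?mulr0 => mS.
- by lra.
- have : m S - beta S <= mu by apply: le_bigmax_cond; rewrite /P iS jS.
  by lra.
- suff : mu <= beta S - m S by lra.
  apply: bigmax_le => [|T /andP[iT jT]]; first by lra.
  (* Uncrossing: delta u vanishes on the intersection and the union. *)
  have := submod T S; have := xle (T :&: S)%SET; have := xle (T :|: S)%SET.
  rewrite /delta !inE iS jS iT (negPf jT) /= !mulr0 !addr0.
  have : m T + m S = m (T :&: S)%SET + m (T :|: S)%SET.
    have mE W : m W = \sum_i (i \in W)%:R * x 0 i.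
      rewrite /m big_mkcond; apply: eq_bigr => k _.
      by case: (k \in W); rewrite ?mul1r ?mul0r.
    rewrite !mE -!big_split /=; apply: eq_bigr => k _.
    by rewrite !inE; case: (k \in T); case: (k \in S); rewrite /=; ring.
  by rewrite -!/(m _); lra.
- by lra.
Qed.

Lemma zonotopeP G b x : zonotope G b x <->
  exists2 a : edge n -> R, (forall u, u \in G -> -1 <= a u <= 1) &
    x = \sum_(u in G) (b u * a u) *: edge_vec R u.
Proof.
split=> [[p pP ->]|[a aP ->]]; last first.
  exists (fun u => (b u * a u) *: edge_vec R u) => // u uG.
  by exists (a u *: edge_vec R u); [exists (a u); rewrite ?aP|rewrite scalerA].
have /choice[a aP] : forall u, exists a : R,
    u \in G -> -1 <= a <= 1 /\ p u = (b u * a) *: edge_vec R u.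
  move=> u; case: (boolP (u \in G)) => [/pP[_ [a a1 ->] <-]|_].
    by exists a; rewrite scalerA.
  by exists 0.
exists a => [u /aP[]//|]; by apply: eq_bigr => u /aP[].
Qed.

(** One inclusion bounds each segment separately; the other is induction on
the number of edges, the remaining weights being submodular. *)
Lemma zonotope_polytope G b : (forall u, u \in G -> 0 < b u) ->
  zonotope G b = polytope (cutfun G b).
Proof.
move=> b0; rewrite eqEsubset; split=> x.
  move=> /zonotopeP[a aP ->].
  have massE S : dot (ind_vec R S)
      (\sum_(u in G) (b u * a u) *: edge_vec R u)
    = \sum_(u in G) b u * a u *
        (((val u).1 \in S)%:R - ((val u).2 \in S)%:R).
    rewrite dot_ind_vec; under eq_bigr do rewrite summxE.
    rewrite exchange_big /=; apply: eq_bigr => u _; rewrite -edge_vec_mass.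
    by rewrite mulr_sumr; apply: eq_bigr => i _; rewrite mxE.
  split=> [S _|]; last by rewrite massE big1 // => u _; rewrite !inE subrr mulr0.
  rewrite massE cutfunE; apply: ler_sum => u uG; rewrite -mulrA.
  rewrite ler_wpM2l ?(ltW (b0 u uG)) // /delta; case/andP: (aP u uG) => a_ge a_le.
  by case: (_ \in S); case: (_ \in S);
    rewrite ?subrr ?subr0 ?sub0r ?mulrN1 ?mulr1 ?mulr0 /=; lra.
move=> [xle x0]; apply/zonotopeP.
have {xle} : forall S, \sum_(i in S) x 0 i <= cutfun G b S.
  move=> S; have [->|ST] := eqVneq S [set: 'I_n.+1]%SET.
    rewrite -dot_ind_vec x0 cutfunE big1 // => u _.
    by rewrite /delta !inE mulr0.
  by rewrite -dot_ind_vec; apply: xle; rewrite properT.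
have {x0} : \sum_i x 0 i = 0.
  by rewrite -[RHS]x0 dot_ind_vec; apply: eq_bigl => i; rewrite !inE.
have [m] := ubnP #|G|; elim: m => // k IH in G x b0 * => cardG x0 xle.
have [G0|[u uG]] := set_0Vmem G.
  move: {IH cardG b0} xle; rewrite {}G0 => xle.
  (* Without edges the singletons give x <= 0 coordinatewise, and the total
     is 0. *)
  exists (fun=> 0) => [u|]; first by rewrite inE.
  rewrite big_set0; apply/rowP => i; rewrite mxE.
  have x_le0 S : \sum_(i in S) x 0 i <= 0.
    by have := xle S; rewrite cutfunE big_set0.
  apply/eqP; rewrite -oppr_eq0; apply/eqP.
  apply: (psumr_eq0P (P := predT) (F := fun k => - x 0 k)) => // [j _|].
    by have := x_le0 [set j]%SET; rewrite big_set1; lra.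
  by rewrite sumrN x0 oppr0.
have b0' v : v \in G :\ u -> 0 < b v by rewrite !inE => /andP[_ /b0].
have [||a a1 xale] := @edge_flow_exists (cutfun (G :\ u)%SET b) u (b u) x (b0 u uG).
- by move=> S T; apply: cutfun_submodular => v /b0'/ltW.
- move=> S; have := xle S.
  by rewrite !cutfunE (big_setD1 u uG) /= addrC.
have [||a' a'1 xE] := IH (G :\ u)%SET (x - (b u * a) *: edge_vec R u) b0' _ _ xale.
- by move: cardG; rewrite (cardsD1 u G) uG.
- under eq_bigr do rewrite !mxE.
  rewrite sumrB x0 -mulr_sumr.
  have := edge_vec_mass u [set: 'I_n.+1]%SET; rewrite !inE subrr.
  under eq_bigl do rewrite inE.
  under eq_bigr do rewrite !mxE.
  by move=> ->; rewrite mulr0 subrr.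
exists (fun v => if v == u then a else a' v) => [v vG|].
  by case: eqP => // /eqP vu; apply: a'1; rewrite !inE vu.
rewrite (big_setD1 u uG) /= eqxx -[LHS](subrK ((b u * a) *: edge_vec R u)) addrC.
congr (_ + _); rewrite xE; apply: eq_bigr => v.
by rewrite !inE => /andP[/negPf-> _].
Qed.
End Zonotopes.

(** * The face lattice of a zonotope *)

(** If f x = f y for distinct x and y, then already A without x, which has
fewer elements, maps onto B. *)
Lemma same_card_surj_inj (T U : choiceType) (A : set T) (B : set U)
    (f : T -> U) :
    finite_set A -> (A #= B)%card -> set_surj A B f ->
  {in A &, injective f}.
Proof.
move=> finA AB surjf x y xA yA fxy; apply: contrapT => xy.
have surjf' : set_surj (A `\ x) B f.
  move=> z /surjf[t At <-]; have [->|tx] := eqVneq t x.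
    exists y => //; split; first exact: set_mem.
    by move=> /= /esym.
  by exists t => //; split => //; apply/eqP.
have : (A #<= A `\ x)%card.
  rewrite (card_le_eql AB).
  have [g] := surjPex.2 (ex_intro _ f surjf').
  exact: surj_card_ge.
have [m Am] := (finite_setP _).1 finA; rewrite (card_le_eql Am).
move=> /(leq_card_fset_set (finite_setD _ finA)).
rewrite fset_setD1 // -(card_fset_set Am) leqNgt.
by rewrite [in ltnRHS](finmap.cardfsD1 x) in_fset_set // xA leqnn.
Qed.

Section FacesOfZonotopes.
Variables (R : realType) (n : nat).
Implicit Types (G H : {set edge n}) (b c : edge n -> R).
Implicit Types (x : 'rV[R]_n.+1) (u : edge n).
Implicit Types (l : {linear 'rV[R]_n.+1 -> R^o}) (F : set 'rV[R]_n.+1).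

Definition zonotope_support G b l : R := \sum_(u in G) b u * `|l (edge_vec R u)|.

Definition zonotope_face G b l : set 'rV[R]_n.+1 :=
  zonotope G b `&` [set x | l x = zonotope_support G b l].

(** A zero sign of [l'] leaves the sign of [l] free: the face exposed by [l']
is cut out by fewer constraints. *)
Definition sign_refines G l l' : Prop := forall u, u \in G ->
  l' (edge_vec R u) != 0 -> Num.sg (l (edge_vec R u)) = Num.sg (l' (edge_vec R u)).

Lemma linear_edge_sum G (d : edge n -> R) l :
  l (\sum_(u in G) d u *: edge_vec R u) = \sum_(u in G) d u * l (edge_vec R u).
Proof. by rewrite linear_sum; apply: eq_bigr => u _; rewrite linearZ. Qed.

Lemma mulr_le_norm (a t : R) : -1 <= a <= 1 -> a * t <= `|t|.
Proof.
move=> /andP[a_ge a_le]; apply: le_trans (ler_norm _) _.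
by rewrite normrM ler_piMl // ler_norml a_ge.
Qed.

Lemma le_zonotope_support G b l x : (forall u, u \in G -> 0 < b u) ->
  zonotope G b x -> l x <= zonotope_support G b l.
Proof.
move=> b0 /zonotopeP[a a1 ->]; rewrite linear_edge_sum.
apply: ler_sum => u uG; rewrite -mulrA ler_wpM2l ?(ltW (b0 u uG)) //.
exact: mulr_le_norm (a1 u uG).
Qed.

(** The support function is the sum of the maxima over the segments, so a
point is maximal exactly when each of its summands is. *)
Lemma zonotope_faceP G b l (a : edge n -> R) :
    (forall u, u \in G -> 0 < b u) -> (forall u, u \in G -> -1 <= a u <= 1) ->
  zonotope_face G b l (\sum_(u in G) (b u * a u) *: edge_vec R u) <->
  forall u, u \in G -> l (edge_vec R u) != 0 -> a u = Num.sg (l (edge_vec R u)).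
Proof.
move=> b0 a1; split=> [[_ /=]|aE].
  rewrite linear_edge_sum => /esym/eqP; rewrite -subr_eq0 -sumrB => /eqP sum0.
  move=> u uG lu0; have gap v : v \in G ->
      0 <= b v * `|l (edge_vec R v)| - b v * a v * l (edge_vec R v).
    move=> vG; rewrite subr_ge0 -mulrA ler_wpM2l ?(ltW (b0 v vG)) //.
    exact: mulr_le_norm (a1 v vG).
  have /eqP := psumr_eq0P gap sum0 uG; rewrite -mulrA -mulrBr mulf_eq0.
  rewrite gt_eqF ?b0 //= subr_eq0 => /eqP /esym; rewrite normrEsg.
  exact: mulIf.
split; first by apply/zonotopeP; exists a.
rewrite /= linear_edge_sum; apply: eq_bigr => u uG; rewrite -mulrA.
have [->|lu0] := eqVneq (l (edge_vec R u)) 0; first by rewrite normr0 mulr0.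
by rewrite normrEsg aE.
Qed.

Lemma sg_itv (t : R) : -1 <= Num.sg t <= 1.
Proof. by case: sgrP => _; apply/andP; split; lra. Qed.

(** A point of the face exposed by [l] whose coefficients carry all the signs
of [l]; with it sign vectors are read off from faces. *)
Definition sign_point G b l : 'rV[R]_n.+1 :=
  \sum_(u in G) (b u * Num.sg (l (edge_vec R u))) *: edge_vec R u.

Lemma sign_point_face G b l : (forall u, u \in G -> 0 < b u) ->
  zonotope_face G b l (sign_point G b l).
Proof. by move=> b0; apply/zonotope_faceP => // u _; apply: sg_itv. Qed.

Lemma zonotope_face_sub G b l l' : (forall u, u \in G -> 0 < b u) ->
  zonotope_face G b l `<=` zonotope_face G b l' <-> sign_refines G l l'.
Proof.
move=> b0; split=> [sub u uG l'u|ref x].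
  have /zonotope_faceP := sub _ (sign_point_face l b0).
  by apply => // v _; apply: sg_itv.
move=> [/[dup] /zonotopeP[a a1 ->] _ lx]; apply/zonotope_faceP => // u uG l'u.
rewrite -ref //.
have /zonotope_faceP : zonotope_face G b l
    (\sum_(v in G) (b v * a v) *: edge_vec R v).
  by split=> //; apply/zonotopeP; exists a.
apply=> //; rewrite -sgr_eq0 ref // sgr_eq0 //.
Qed.

Lemma is_face_zonotope G b F : (forall u, u \in G -> 0 < b u) ->
  is_face (zonotope G b) F <-> F = set0 \/ exists l, F = zonotope_face G b l.
Proof.
move=> b0; split=> [[l [c [valid FE]]]|[->|[l ->]]]; last 2 first.
- exists \0, 1; split=> [x _|]; first by rewrite ler01.
  by apply/esym/seteqP; split=> // x [_ /= /esym/eqP]; rewrite oner_eq0.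
- by exists l, (zonotope_support G b l); split=> // x; apply: le_zonotope_support.
have [->|/set0P[x Fx]] := eqVneq F set0; [by left|right; exists l].
move: Fx; rewrite FE => -[Zx /= lx].
suff -> : c = zonotope_support G b l by [].
have [Zs ls] := sign_point_face l b0.
by apply/eqP; rewrite eq_le -{1}lx le_zonotope_support //= -ls valid.
Qed.

(** Taking the union over all smaller exposed faces, instead of choosing a form
that exposes F, makes the map independent of a choice and sends the empty face
to the empty face. *)
Definition face_transfer G b H c F : set 'rV[R]_n.+1 :=
  \bigcup_(l in [set l | zonotope_face G b l `<=` F]) zonotope_face H c l.

Lemma face_transfer0 G b H c : (forall u, u \in G -> 0 < b u) ->
  face_transfer G b H c set0 = set0.
Proof.
move=> b0; apply/seteqP; split=> // x [l /= sub _].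
exact: sub (sign_point_face l b0).
Qed.

(** If [l'] exposes a subface for G, its signs refine those of [l] on G, hence
on H. *)
Lemma face_transferE G b H c l : (forall u, u \in G -> 0 < b u) ->
    (forall u, u \in H -> 0 < c u) -> H \subset G ->
  face_transfer G b H c (zonotope_face G b l) = zonotope_face H c l.
Proof.
move=> b0 c0 HG; apply/seteqP; split=> [x [l' /= sub xl']|x xl];
  last by exists l.
apply: (zonotope_face_sub l' l c0).2 xl' => u uH.
apply: (zonotope_face_sub l' l b0).1 => //.
exact: (fintype.subsetP HG).
Qed.

Lemma face_transfer_surj G b H c : (forall u, u \in G -> 0 < b u) ->
    (forall u, u \in H -> 0 < c u) -> H \subset G ->
  set_surj (faces (zonotope G b)) (faces (zonotope H c)) (face_transfer G b H c).
Proof.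
move=> b0 c0 HG F /(is_face_zonotope _ c0)[->|[l ->]].
  exists set0; last by rewrite face_transfer0.
  by apply/(is_face_zonotope _ b0); left.
exists (zonotope_face G b l); last by rewrite face_transferE.
by apply/(is_face_zonotope _ b0); right; exists l.
Qed.

Lemma zonotope_same_type G b c : (forall u, u \in G -> 0 < b u) ->
  (forall u, u \in G -> 0 < c u) -> same_type (zonotope G b) (zonotope G c).
Proof.
move=> b0 c0; have mono F F' : is_face (zonotope G b) F ->
    is_face (zonotope G b) F' ->
    F `<=` F' <-> face_transfer G b G c F `<=` face_transfer G b G c F'.
  move=> /(is_face_zonotope _ b0)[->|[l ->]].
    by rewrite face_transfer0 //; split=> _; apply: sub0set.
  move=> /(is_face_zonotope _ b0)[->|[l' ->]].
    rewrite face_transfer0 // face_transferE //; split=> sub.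
      by case: (sub _ (sign_point_face l b0)).
    by case: (sub _ (sign_point_face l c0)).
  rewrite !face_transferE //.
  rewrite (propext (zonotope_face_sub l l' b0)).
  by rewrite (propext (zonotope_face_sub l l' c0)).
exists (face_transfer G b G c) => //; split.
- move=> F /(is_face_zonotope _ b0)[->|[l ->]].
    by rewrite face_transfer0 //; apply/(is_face_zonotope _ c0); left.
  by rewrite face_transferE //; apply/(is_face_zonotope _ c0); right; exists l.
- move=> F F' /set_mem fF /set_mem fF' eqt; apply/seteqP; split.
    by apply/(mono _ _ fF fF'); rewrite eqt.
  by apply/(mono _ _ fF' fF); rewrite eqt.
- exact: face_transfer_surj.
Qed.

(** A face is determined by one of finitely many sign vectors, or is empty. *)
Lemma finite_faces_zonotope G b : (forall u, u \in G -> 0 < b u) ->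
  finite_set (faces (zonotope G b)).
Proof.
move=> b0; pose sgn l := [ffun u => (0 < l (edge_vec R u), l (edge_vec R u) < 0)].
pose of_sgn s := \bigcup_(l in [set l | sgn l = s]) zonotope_face G b l.
apply: (@sub_finite_set _ _ ([set set0] `|` range of_sgn)); last first.
  rewrite finite_setU; split; first exact: finite_set1.
  by apply: finite_image; exact: finite_finset.
move=> F /(is_face_zonotope _ b0)[->|[l ->]]; [by left|right].
exists (sgn l) => //; apply/seteqP; split=> [x [l' /= sl xl']|x xl]; last by exists l.
apply: (zonotope_face_sub l' l b0).2 xl' => u uG _.
move/ffunP: sl => /(_ u); rewrite !ffunE.
by case=> + +; case: sgrP => //; case: sgrP => // *; lra.
Qed.

Definition potential (w : 'I_n.+1 -> R) x : R^o := \sum_i w i * x 0 i.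

Lemma potential_is_linear w : linear (potential w).
Proof.
move=> a x y; rewrite /potential scaler_sumr -big_split; apply: eq_bigr => i _.
by rewrite !mxE /= mulrDr mulrCA.
Qed.

HB.instance Definition _ w := GRing.isLinear.Build R 'rV[R]_n.+1 R^o _
  (potential w) (potential_is_linear w).

Lemma potential_edge w u :
  potential w (edge_vec R u) = w (val u).1 - w (val u).2.
Proof.
have basisE k : \sum_i w i * basis_vec R k 0 i = w k.
  rewrite (bigD1 k) //= big1 ?mxE ?eqxx ?mulr1 ?addr0 // => i ik.
  by rewrite mxE (negPf ik) andbF mulr0.
rewrite /potential -!basisE -sumrB; apply: eq_bigr => i _.
by rewrite !mxE mulrBr.
Qed.

(** Take a form with equal values at the two ends of u and distinct values
otherwise: it is nonzero on every edge other than u. A small increase of its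
value at one end changes the sign on u and on no other edge. *)
Lemma new_edge_splits_cone H u : u \notin H ->
  exists l l', [/\ sign_refines H l l', sign_refines H l' l,
    l (edge_vec R u) = 0 & l' (edge_vec R u) != 0].
Proof.
move=> uH; pose i := (val u).1; pose j := (val u).2.
(* The values are integers, so an increase by 1/2 keeps nonzero signs. *)
pose w k : R := (if k == j then i else k)%:R.
pose w' k : R := w k + (if k == i then 2^-1 else 0).
have ij : (i == j) = false.
  by apply/negbTE; rewrite -val_eqE /= ltn_eqF //; apply: (valP u).
have sgE v : v \in H ->
    Num.sg (potential w (edge_vec R v)) = Num.sg (potential w' (edge_vec R v)).
  move=> vH; rewrite !potential_edge.
  pose f k : nat := if k == j then i else k.
  have fvN : f (val v).1 != f (val v).2.
    have := valP v; have := valP u; rewrite /= -/i -/j /f => lt_ij lt_v.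
    case: ((val v).1 =P j) => [v1|_]; case: ((val v).2 =P j) => [v2|_];
      last by rewrite ltn_eqF.
    - by rewrite v1 v2 ltnn in lt_v.
    - by rewrite ltn_eqF // (ltn_trans lt_ij) // -v1.
    - apply: contra_neq ((memPn uH) v vH) => v1.
      by apply/val_inj; rewrite [LHS]surjective_pairing v2 (val_inj v1) -surjective_pairing.
  have w'E k : w k = (f k)%:R /\ w k <= w' k <= w k + 2^-1.
    split=> //; rewrite /w'; case: eqP => _; rewrite ?addr0; lra.
  have [-> /andP[? ?]] := w'E (val v).1; have [-> /andP[? ?]] := w'E (val v).2.
  move: fvN; rewrite neq_ltn => /orP[] lt_f.
    have : (f (val v).1).+1%:R <= (f (val v).2)%:R :> R by rewrite ler_nat.
    by rewrite -natr1 => ?; rewrite !ltr0_sg; lra.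
  have : (f (val v).2).+1%:R <= (f (val v).1)%:R :> R by rewrite ler_nat.
  by rewrite -natr1 => ?; rewrite !gtr0_sg; lra.
have wu : potential w (edge_vec R u) = 0.
  by rewrite potential_edge /w -/i -/j eqxx ij subrr.
have w'u : potential w' (edge_vec R u) != 0.
  rewrite potential_edge /w' /w -/i -/j !eqxx (eq_sym j i) !ij /=.
  by rewrite addr0 addrAC subrr add0r invr_neq0 ?pnatr_eq0.
exists (potential w), (potential w'); split=> // v vH _; first exact: sgE.
by apply/esym/sgE.
Qed.

(** If u is in G but not in H, restriction of sign vectors to H identifies two
faces for G; a surjection between finite sets of equal size cannot do this. *)
Lemma zonotope_faces_card_inj G b H c : (forall u, u \in G -> 0 < b u) ->
    (forall u, u \in H -> 0 < c u) -> H \subset G ->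
    (faces (zonotope G b) #= faces (zonotope H c))%card ->
  H = G.
Proof.
move=> b0 c0 HG cardE; apply/eqP; rewrite finset.eqEsubset HG /=.
apply/fintype.subsetP => u uG; apply: contrapT => /negP uH.
have inj := same_card_surj_inj (finite_faces_zonotope b0) cardE
  (face_transfer_surj b0 c0 HG).
have [l [l' [ll' l'l lu l'u]]] := new_edge_splits_cone uH.
have faceG k : zonotope_face G b k \in faces (zonotope G b).
  by rewrite inE; apply/(is_face_zonotope _ b0); right; exists k.
have faceE : zonotope_face G b l = zonotope_face G b l'.
  apply: inj => //; rewrite !face_transferE //.
  by apply/seteqP; split; apply: (zonotope_face_sub _ _ c0).2.
have : sign_refines G l l' by apply: (zonotope_face_sub _ _ b0).1; rewrite faceE.
by move=> /(_ u uG l'u); rewrite lu sgr0 => /esym/eqP; rewrite sgr_eq0 (negPf l'u).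
Qed.

End FacesOfZonotopes.

(** * Type domains *)

Section CutCone.
Variables (R : realType) (n : nat).
Implicit Types (G H : {set edge n}) (b c : edge n -> R).
Implicit Types (beta gamma : setfun R n) (u v : edge n).

(** The coefficient of delta_u in a cut function beta: for u = (i, j), every
edge other than u contributes equally to beta(i) + beta(j) and beta(ij), while
u contributes to the first sum twice and to the second not at all. *)
Definition edge_coef u beta : R :=
  (beta [set (val u).1]%SET + beta [set (val u).2]%SET
    - beta [set (val u).1; (val u).2]%SET) / 2.

Lemma edge_coef_delta u v : edge_coef u (delta R v) = (u == v)%:R.
Proof.
case: u v => [[i j] /= ij] [[k l] /= kl].
rewrite /edge_coef /delta -val_eqE /= xpair_eqE !inE -!val_eqE /=.
have [ki|ki] := eqVneq (val k) (val i); have [li|li] := eqVneq (val l) (val i);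
have [kj|kj] := eqVneq (val k) (val j); have [lj|lj] := eqVneq (val l) (val j).
all: rewrite ?ki ?li ?kj ?lj /=.
all: rewrite ?eqxx /=; try lra.
all: by exfalso; move: ki li kj lj ij kl => /=; lia.
Qed.

Lemma edge_coef_cutfun G b u : edge_coef u (cutfun G b) = if u \in G then b u else 0.
Proof.
have -> : edge_coef u (cutfun G b) = \sum_(v in G) b v * edge_coef u (delta R v).
  rewrite /edge_coef !cutfunE -big_split -sumrB mulr_suml.
  by apply: eq_bigr => v _; rewrite /=; ring.
case: ifP => uG.
  rewrite (bigD1 u) //= edge_coef_delta eqxx mulr1 big1 ?addr0 // => v /andP[_ vu].
  by rewrite edge_coef_delta eq_sym (negPf vu) mulr0.
rewrite big1 // => v vG; rewrite edge_coef_delta.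
by case: eqP => [uv|_]; [rewrite uv vG in uG|rewrite mulr0].
Qed.

Lemma cutfun_extend G b :
  cutfun G b = \sum_u (if u \in G then b u else 0) *: delta R u.
Proof.
rewrite /cutfun big_mkcond; apply: eq_bigr => u _.
by case: ifP; rewrite ?scale0r.
Qed.

Lemma cutfun_support b : (forall u, 0 <= b u) ->
  \sum_u b u *: delta R u = cutfun [set u | 0 < b u]%SET b.
Proof.
move=> b0; rewrite cutfun_extend; apply: eq_bigr => u _; rewrite inE.
by have := b0 u; rewrite le_eqVlt => /orP[/eqP<-|->//]; rewrite ltxx.
Qed.

Lemma cut_cone_is_cut G : cut_cone R G `<=` is_cut (R := R) (n := n).
Proof.
move=> _ [b b0 ->]; exists (fun u => if u \in G then b u else 0).
  by move=> u; case: ifP => // /b0/ltW.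
exact: cutfun_extend.
Qed.

Definition ptws_setfun := {ptws {set 'I_n.+1} -> R^o}.

Lemma continuous_eval S : continuous (fun beta : ptws_setfun => beta S : R).
Proof. exact: (@proj_continuous _ (fun=> R^o) S). Qed.

Lemma continuous_edge_coef u :
  continuous (fun beta : ptws_setfun => edge_coef u beta : R).
Proof.
move=> beta; rewrite /edge_coef; have evalE S := @continuous_eval S beta.
exact: (cvgM (cvgB (cvgD (evalE _) (evalE _)) (evalE _)) (cvg_cst _)).
Qed.

Lemma cvg_setfun (T : Type) (F : set_system T) (f : T -> ptws_setfun) beta :
    Filter F -> (forall S, f x S @[x --> F] --> (beta S : R^o)) ->
  f @ F --> (beta : ptws_setfun).
Proof.
move=> FF cvgS; apply/cvg_sup => S U [V [[W oW <-] WS VU]].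
apply: (filterS VU); apply: (cvgS S W).
exact: open_nbhs_nbhs.
Qed.

Lemma continuous_line beta gamma :
  continuous (fun t : R^o => beta + t *: gamma : ptws_setfun).
Proof.
move=> t; apply: cvg_setfun => S.
apply: (@cvgD _ _ _ _ _ (fun=> beta S) (fun x : R^o => (x *: gamma) S)
  _ (t * gamma S)); first exact: cvg_cst.
by apply: cvgMl; exact: cvg_id.
Qed.

Lemma convex_connected (A : set ptws_setfun) :
    (forall beta gamma (t : R), A beta -> A gamma -> 0 <= t <= 1 ->
      A (beta + t *: (gamma - beta))) ->
  connected A.
Proof.
move=> convA; have [->|/set0P[beta Abeta]] := eqVneq A set0; first exact: connected0.
suff -> : A = connected_component A beta by exact: component_connected.
apply/seteqP; split; last exact: connected_component_sub.
move=> gamma Agamma.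
exists [set beta + t *: ((gamma : setfun R n) - beta) | t in `[0, 1]%classic]; last first.
  by exists 1; rewrite /= ?in_itv /= ?ler01 ?lexx // scale1r addrC subrK.
split.
- by exists 0; rewrite /= ?in_itv /= ?ler01 ?lexx // scale0r addr0.
- by move=> _ [t /= /[!in_itv] /= t01 <-]; apply: convA.
- apply: connected_continuous_connected.
    exact: segment_connected.
  apply: continuous_subspaceT; exact: continuous_line.
Qed.

Lemma edge_coef_gt0 H beta u : cut_cone R H beta ->
  (0 < edge_coef u beta) = (u \in H).
Proof.
move=> [c c0 ->]; rewrite edge_coef_cutfun; case: ifP => [/c0//|_].
exact: ltxx.
Qed.

Lemma is_cut_support beta : is_cut beta -> exists H, cut_cone R H beta.
Proof.
move=> [c c0 ->]; exists [set u | 0 < c u]%SET, c => [u|]; first by rewrite inE.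
exact: cutfun_support.
Qed.

(** Only the number of faces matters, so either direction of the relation of
being of the same type gives the contradiction. *)
Lemma same_type_nested_cones G H beta gamma :
    cut_cone R G beta -> cut_cone R H gamma -> H \subset G ->
    same_type (polytope gamma) (polytope beta) \/
    same_type (polytope beta) (polytope gamma) ->
  H = G.
Proof.
move=> [b b0 ->] [c c0 ->] HG.
rewrite -!zonotope_polytope // => -[] [phi bij _];
  apply: (zonotope_faces_card_inj b0 c0 HG); last first.
  by apply/card_set_bijP; exists phi.
by apply/card_esym/card_set_bijP; exists phi.
Qed.

(** The cone is connected because it is convex. Conversely, in a connected set
of cut functions of the same type, it is relatively open (where the
coefficients on G are positive, the support contains G) and relatively closed
(where those off G are at most 0, the support lies in G). *)
Lemma type_domain_cut_cone G b : (forall u, u \in G -> 0 < b u) ->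
  type_domain (cutfun G b) = cut_cone R G.
Proof.
move=> b0; have Gb : cut_cone R G (cutfun G b) by exists b.
pose A := [set beta : setfun R n | is_cut beta /\
  same_type (polytope beta) (polytope (cutfun G b))].
have GA : cut_cone R G `<=` A.
  move=> beta Gbeta; split; first exact: cut_cone_is_cut Gbeta.
  case: Gbeta => c c0 ->; rewrite -!zonotope_polytope //.
  exact: zonotope_same_type.
apply/seteqP; split=> [beta|]; last first.
  apply: (@connected_component_max ptws_setfun A (cut_cone R G) _ Gb GA).
  apply: convex_connected.
  move=> _ _ t [c c0 ->] [d d0 ->] /andP[t0 t1].
  exists (fun u => c u + t * (d u - c u)).
    move=> u uG; have := c0 u uG; have := d0 u uG; nra.
  apply/funext => S; rewrite !fctE !cutfunE /GRing.scale /= -sumrB mulr_sumr.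
  by rewrite -big_split /=; apply: eq_bigr => u _; ring.
case=> C [Cb CA connC] Cbeta.
have same_support H gamma : C gamma -> cut_cone R H gamma ->
    H \subset G \/ G \subset H -> H = G.
  move=> /CA[_ st] Hgamma [HG|GH].
    by apply: (same_type_nested_cones Gb Hgamma HG); left.
  by apply/esym/(same_type_nested_cones Hgamma Gb GH); right.
suff CE : C `&` cut_cone R G = C by rewrite -CE in Cbeta; case: Cbeta.
apply: connC; first by exists (cutfun G b).
- exists [set gamma : ptws_setfun | forall u, u \in G -> 0 < edge_coef u gamma].
    rewrite openE => gamma pos.
    apply: (@filter_forall _ _ (fun u gamma => u \in G -> 0 < edge_coef u gamma)
      (nbhs gamma) _).
    move=> u; case: (boolP (u \in G)) => [uG|_]; last by apply: nearW.
    have /(_ (@open_gt R 0)) := (continuousP _).1 (@continuous_edge_coef u) [set x | 0 < x].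
    rewrite openE => /(_ gamma (pos u uG)).
    by apply: filterS => x /= ? _.
  apply/seteqP; split=> gamma [Cgamma cone]; split=> //.
    by move=> u uG; rewrite (edge_coef_gt0 _ cone).
  have [H Hgamma] := is_cut_support (CA _ Cgamma).1.
  suff <- : H = G by [].
  apply: (same_support H gamma) => //; right; apply/fintype.subsetP => u /cone.
  by rewrite (edge_coef_gt0 _ Hgamma).
- exists (\bigcap_(u in [set u | u \notin G])
    ((fun gamma : ptws_setfun => edge_coef u gamma : R) @^-1` [set x | x <= 0])).
    apply: closed_bigI => u _; apply: ((continuous_closedP _).1 _ _ (@closed_le R 0)).
    exact: continuous_edge_coef.
  apply/seteqP; split=> gamma [Cgamma cone]; split=> //.
    by move=> u /= uG; rewrite leNgt (edge_coef_gt0 _ cone).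
  have [H Hgamma] := is_cut_support (CA _ Cgamma).1.
  suff <- : H = G by [].
  apply: (same_support H gamma) => //; left; apply/fintype.subsetP => u uH.
  apply: contrapT => /negP /cone /=.
  by rewrite leNgt (edge_coef_gt0 _ Hgamma) uH.
Qed.

Definition closed_cut_cone G : set (setfun R n) :=
  [set beta | exists2 b : edge n -> R,
    (forall u, u \in G -> 0 <= b u) & beta = cutfun G b].

(** Adding a small positive multiple of the cut function with all weights 1
moves the closed cone into the open one. *)
Lemma closure_cut_cone G : closure_setfun (cut_cone R G) = closed_cut_cone G.
Proof.
apply/seteqP; split=> beta.
  rewrite /closure_setfun closureE.
  pose D := \bigcap_(u in [set u | u \in G])
    ((fun gamma : ptws_setfun => edge_coef u gamma : R) @^-1` [set x | 0 <= x])
    `&` \bigcap_(S in [set: {set 'I_n.+1}])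
    ((fun gamma : ptws_setfun =>
       (gamma S : R) - \sum_(u in G) edge_coef u gamma * delta R u S)
      @^-1` [set 0]).
  move=> /(_ D) [].
    split; last first.
      move=> _ [b b0 ->]; split=> [u /= uG|S _ /=].
        by rewrite edge_coef_cutfun uG ltW ?b0.
      apply/eqP; rewrite subr_eq0 cutfunE; apply/eqP/eq_bigr => u uG.
      by rewrite edge_coef_cutfun uG.
    apply: closedI.
      apply: closed_bigI => u _; apply: ((continuous_closedP _).1 _ _ (@closed_ge R 0)).
      exact: continuous_edge_coef.
    apply: closed_bigI => S _; apply: ((continuous_closedP _).1 _ _ (@closed_eq R 0)).
    have sum_cont : continuous (fun gamma : ptws_setfun =>
        \sum_(u in G) edge_coef u gamma * delta R u S : R).
      apply: (@continuous_big R _ +%R 0 (mem G) (@add_continuous R)) => u _ gamma.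
      exact: (cvgM (@continuous_edge_coef u gamma) (cvg_cst _)).
    by move=> gamma; exact: (cvgB (@continuous_eval S gamma) (sum_cont gamma)).
  move=> beta_ge0 betaE; exists (edge_coef^~ beta) => [u /beta_ge0//|].
  apply/funext => S; rewrite cutfunE.
  by apply/eqP; rewrite -subr_eq0; apply/eqP/(betaE S).
case=> b b0 ->; rewrite /closure_setfun.
have line_cont := @continuous_line (cutfun G b) (cutfun G (fun=> 1)) 0.
move=> U; rewrite -[X in nbhs X](addr0 (cutfun G b)).
rewrite -(scale0r (cutfun G (fun=> 1))) => /line_cont nearU.
have /nbhs_ballP[e /= e0 eU] := nearU.
exists (cutfun G b + (e / 2) *: cutfun G (fun=> 1)); split; last first.
  apply: eU; rewrite /ball /= sub0r normrN gtr0_norm; lra.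
exists (fun u => b u + e / 2) => [u uG|]; first by have := b0 u uG; lra.
apply/funext => S; rewrite !fctE !cutfunE /GRing.scale /= mulr_sumr -big_split.
by apply: eq_bigr => u _ /=; ring.
Qed.

End CutCone.
Arguments closed_cut_cone R {n} G.

(** * Faces of the closed principal domain *)

Section QuadraticForms.
Variables (R : realType) (n : nat).
Implicit Types (G : {set edge n}) (b c : edge n -> R) (S : {set 'I_n.+1}).
Implicit Types (beta : setfun R n) (u v : edge n) (f : formfun R n).

(** The orthogonal projection of e_S to the hyperplane; differences of
coordinates are those of e_S. *)
Definition centered_ind_vec S : 'rV[R]_n.+1 :=
  ind_vec R S - const_mx (#|S|%:R / n.+1%:R).

Lemma centered_ind_vec_sum0 S : \sum_i centered_ind_vec S 0 i == 0.
Proof.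
under eq_bigr do rewrite !mxE ind_vecE.
rewrite sumrB sumr_const card_ord -[X in _ - X]mulr_natr divfK ?pnatr_eq0 //.
rewrite -sum1_card natr_sum [X in _ - X]big_mkcond subr_eq0.
by apply/eqP/eq_bigr => i _; case: (i \in S).
Qed.

Definition hyperplane_point S : hyperplane R n :=
  exist _ (centered_ind_vec S) (centered_ind_vec_sum0 S).

Definition cut_of_form f : setfun R n := fun S => f (hyperplane_point S).

Lemma cut_of_edge_form u : cut_of_form (edge_form R u) = delta R u.
Proof.
apply/funext => S; rewrite /cut_of_form /edge_form /delta /= !mxE !ind_vecE.
by case: (_ \in S); case: (_ \in S) => /=; ring.
Qed.

Lemma cut_of_form_sum G b :
  cut_of_form (\sum_(u in G) b u *: edge_form R u) = cutfun G b.
Proof.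
apply/funext => S; rewrite cutfunE /cut_of_form fct_sumE.
by apply: eq_bigr => u _; rewrite -cut_of_edge_form.
Qed.

Definition form_of_cut beta : formfun R n :=
  \sum_u edge_coef u beta *: edge_form R u.

Lemma edge_coef_linear u (a : R) beta gamma :
  edge_coef u (a *: beta + gamma) = a * edge_coef u beta + edge_coef u gamma.
Proof. by rewrite /edge_coef !fctE /GRing.scale /=; ring. Qed.

Lemma form_of_cut_is_linear : linear form_of_cut.
Proof.
move=> a beta gamma; rewrite /form_of_cut scaler_sumr -big_split /=.
by apply: eq_bigr => u _; rewrite edge_coef_linear scalerDl scalerA.
Qed.

HB.instance Definition _ := GRing.isLinear.Build R (setfun R n) (formfun R n) _
  form_of_cut form_of_cut_is_linear.

Lemma form_of_cutfun G b :
  form_of_cut (cutfun G b) = \sum_(u in G) b u *: edge_form R u.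
Proof.
rewrite /form_of_cut [RHS]big_mkcond; apply: eq_bigr => u _.
by rewrite edge_coef_cutfun; case: ifP; rewrite ?scale0r.
Qed.

Lemma form_of_delta u : form_of_cut (delta R u) = edge_form R u.
Proof.
have -> : delta R u = cutfun [set u]%SET (fun=> 1).
  by rewrite /cutfun big_set1 scale1r.
by rewrite form_of_cutfun big_set1 scale1r.
Qed.

Lemma form_of_cutK G b : cut_of_form (form_of_cut (cutfun G b)) = cutfun G b.
Proof. by rewrite form_of_cutfun cut_of_form_sum. Qed.

(** The linear form that supports the principal domain along the face of G: on
the domain the coefficients are nonnegative, so this vanishes only if all those
off G do. *)
Definition coef_off G f : R^o := - \sum_(u | u \notin G) edge_coef u (cut_of_form f).

Lemma coef_off_is_linear G : linear (coef_off G).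
Proof.
move=> a f g; rewrite /coef_off scalerN -opprD scaler_sumr -big_split /=.
by congr (- _); apply: eq_bigr => u _; rewrite -edge_coef_linear.
Qed.

HB.instance Definition _ G := GRing.isLinear.Build R (formfun R n) R^o _
  (coef_off G) (coef_off_is_linear G).

Definition form_face G : set (formfun R n) := form_of_cut @` closed_cut_cone R G.

Lemma closed_principal_domainE :
  closed_principal_domain R n = form_face [set: edge n]%SET.
Proof.
have sumT b : form_of_cut (cutfun [set: edge n]%SET b) = \sum_u b u *: edge_form R u.
  by rewrite form_of_cutfun; apply: eq_bigl => u; rewrite inE.
apply/seteqP; split=> [f [b b0 ->]|_ [_ [b b0 ->] <-]].
  by exists (cutfun [set: edge n]%SET b) => //; exists b.
by exists b => // u; rewrite b0 ?inE.
Qed.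

Lemma form_face_is_face G : is_face (closed_principal_domain R n) (form_face G).
Proof.
rewrite closed_principal_domainE; exists (coef_off G), 0.
have coefE b : coef_off G (form_of_cut (cutfun [set: edge n]%SET b))
    = - \sum_(u | u \notin G) b u.
  congr (- _); apply: eq_bigr => u _.
  by rewrite form_of_cutK edge_coef_cutfun inE.
split=> [_ [_ [b b0 ->] <-]|].
  apply: (le_trans (y := - \sum_(u | u \notin G) b u)); first by rewrite -(coefE b).
  by rewrite oppr_le0; apply: sumr_ge0 => u _; rewrite b0 ?inE.
have extendE b : cutfun [set: edge n]%SET (fun u => if u \in G then b u else 0)
    = cutfun G b.
  apply/funext => S; rewrite !cutfunE [RHS]big_mkcond [LHS]big_mkcond.
  by apply: eq_bigr => u _; rewrite inE; case: ifP; rewrite ?mul0r.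
apply/seteqP; split=> [_ [_ [b b0 ->] <-]|_ [[_ [b b0 ->] <-]]].
  rewrite -extendE; split.
    exists (cutfun [set: edge n]%SET (fun u => if u \in G then b u else 0)) => //.
    by exists (fun u => if u \in G then b u else 0) => // u _; case: ifP => // /b0.
  by rewrite /= [LHS]coefE big1 ?oppr0 // => u /negPf ->.
move=> /(etrans (esym (coefE b)))/eqP; rewrite oppr_eq0 => /eqP sum0.
have b00 u : u \notin G -> b u = 0.
  by apply: (psumr_eq0P (P := fun u => u \notin G) _ sum0) => v _; rewrite b0 ?inE.
exists (cutfun G b); first by exists b => // u _; rewrite b0 ?inE.
rewrite -extendE; congr (form_of_cut (cutfun _ _)); apply/funext => u.
by case: (boolP (u \in G)) => // /b00.
Qed.

Lemma form_of_cut_bij G (A : set (setfun R n)) : A `<=` closed_cut_cone R G ->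
  set_bij A (form_of_cut @` A) form_of_cut.
Proof.
move=> Acone; split; [by move=> beta Abeta; exists beta| |apply: subset_refl].
move=> beta gamma /set_mem/Acone[b _ ->] /set_mem/Acone[c _ ->] eqf.
by rewrite -form_of_cutK eqf form_of_cutK.
Qed.

Lemma cut_cone_closed G : cut_cone R G `<=` closed_cut_cone R G.
Proof. by move=> _ [b b0 ->]; exists b => // u /b0/ltW. Qed.

(** A point of the relative interior can be prolonged away from the form with
all coefficients 1, which forces its coefficients to be positive. Conversely a
form with coefficients b > 0 can be prolonged away from one with coefficients c
by any factor eps with eps * (c - b) <= b. *)
Lemma relint_form_face G : relint (form_face G) = form_of_cut @` cut_cone R G.
Proof.
have extrapolate b c (e : R) : form_of_cut (cutfun G b)
    + e *: (form_of_cut (cutfun G b) - form_of_cut (cutfun G c))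
    = form_of_cut (cutfun G (fun u => b u + e * (b u - c u))).
  rewrite !form_of_cutfun -sumrB scaler_sumr -big_split; apply: eq_bigr => u _.
  by rewrite /= scalerDl -scalerBl scalerA.
apply/seteqP; split=> [_ [[_ [b b0 ->] <-]]|_ [_ [b b0 ->] <-]].
  have one : form_face G (form_of_cut (cutfun G (fun=> 1))).
    by exists (cutfun G (fun=> 1)) => //; exists (fun=> 1).
  move=> /(_ _ one)[e e0]; rewrite extrapolate => -[_ [c c0 ->]].
  move=> /(congr1 cut_of_form); rewrite !form_of_cutK => cE.
  exists (cutfun G b) => //; exists b => // u uG.
  have := c0 u uG; have := congr1 (edge_coef u) cE.
  rewrite !edge_coef_cutfun uG => ->; have := b0 u uG; nra.
split; first by exists (cutfun G b) => //; apply: cut_cone_closed; exists b.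
move=> _ [_ [c c0 ->] <-].
(* Since c u / b u <= s for every u, the factor 1 / (1 + s) will do. *)
pose s := \sum_(u in G) c u / b u.
have s0 : 0 <= s by apply: sumr_ge0 => u uG; rewrite divr_ge0 ?c0 // ltW ?b0.
exists (1 + s)^-1; first by rewrite invr_gt0; lra.
rewrite extrapolate; eexists; last reflexivity.
eexists; last reflexivity; move=> u uG /=.
have cs : c u / b u <= s.
  rewrite /s (bigD1 u) //= ler_wpDr // sumr_ge0 // => v /andP[vG _].
  by rewrite divr_ge0 ?c0 // ltW ?b0.
have : c u <= s * b u by rewrite -ler_pdivrMr ?b0.
have := b0 u uG; have : 0 < (1 + s)^-1 by rewrite invr_gt0; lra.
have : (1 + s)^-1 * (1 + s) = 1 by rewrite mulVf // gt_eqF //; lra.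
move: ((1 + s)^-1) => e es e0 bu cu.
suff : e * c u <= e * (s * b u) by nra.
by rewrite ler_wpM2l // ltW.
Qed.

End QuadraticForms.

Arguments form_face R {n} G.

Theorem theorem2 (R : realType) (n : nat) (G : {set edge n})
    (b : edge n -> R) (hb : forall u, u \in G -> 0 < b u) :
  [/\ zonotope G b = polytope (cutfun G b),
      type_domain (cutfun G b) = cut_cone R G
    & exists F : set (formfun R n),
        is_face (closed_principal_domain R n) F /\
        exists Phi : {linear setfun R n -> formfun R n},
          [/\ forall u, Phi (delta R u) = edge_form R u,
              set_bij (type_domain (cutfun G b)) (relint F) Phi
            & set_bij (closure_setfun (type_domain (cutfun G b))) F Phi]].
Proof.
split; [exact: zonotope_polytope|exact: type_domain_cut_cone|].
exists (form_face R G); split; first exact: form_face_is_face.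
exists (form_of_cut (R := R) (n := n)); rewrite type_domain_cut_cone //; split.
- exact: form_of_delta.
- rewrite relint_form_face; apply: form_of_cut_bij.
  exact: cut_cone_closed.
- by rewrite closure_cut_cone; apply: form_of_cut_bij; apply: subset_refl.
Qed.
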